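(* Let $F$ be a field, and let $M$ be a cancellative and torsion-free pre-Schreier monoid (commutative, written additively). If $M$ is an MCD monoid, then the monoid algebra $F[M]$ is an MCD domain.
   Context: A monoid means a cancellative commutative semigroup with identity. It is torsion-free if $nb=nc$ (additive notation) with $n\ge 1$ implies $b=c$. Divisibility: $b\mid_M a$ if $a=b+c$ for some $c\in M$ (additive notation; $a=bc$ in multiplicative notation). For a nonempty finite subset $S$ of $M$, a common divisor $d\in M$ of $S$ (i.e. $d\mid_M s$ for all $s\in S$) is a maximal common divisor (MCD) of $S$ if the only common divisors of $\{s-d : s\in S\}$ (multiplicatively, $\{s/d : s\in S\}$) in $M$ are the units (invertible elements) of $M$. $M$ is an MCD monoid if every nonempty finite subset of $M$ has an MCD. An integral domain $R$ is an MCD domain if its multiplicative monoid of nonzero elements $R^*=R\setminus\{0\}$ is an MCD monoid. $M$ is pre-Schreier if every $a\in M$ is primal: whenever $a\mid_M b+c$ with $b,c\in M$, one can write $a=b'+c'$ with $b',c'\in M$, $b'\mid_M b$ and $c'\mid_M c$. $F[M]$ denotes the monoid algebra of $M$ over $F$: polynomial expressions in $x$ with exponents in $M$ and coefficients in $F$; it is an integral domain when $M$ is cancellative and torsion-free. *)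

(* Defs.v *)
From HB Require Import structures.
From mathcomp Require Import all_boot all_algebra finmap monalg.

Set Implicit Arguments.
Unset Strict Implicit.
Unset Printing Implicit Defensive.

Import GRing.Theory.
Local Open Scope fset_scope.
Local Open Scope ring_scope.

(* Commutative monoids are written additively, as nmodTypes. *)
Section Monoids.
Variable M : nmodType.
Implicit Types (a b c d e : M) (n : nat) (S : M -> Prop).

Definition cancellative : Prop := forall a b c, a + b = a + c -> b = c.

Definition torsion_free : Prop :=
  forall n b c, (1 <= n)%N -> b *+ n = c *+ n -> b = c.

Definition mdivides b a : Prop := exists c, a = b + c.

Definition invertible a : Prop := exists b, a + b = 0.

Definition primal a : Prop := forall b c, mdivides a (b + c) ->
  exists b' c', [/\ a = b' + c', mdivides b' b & mdivides c' c].

Definition pre_schreier : Prop := forall a, primal a.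

Definition common_divisor S d : Prop := forall s, S s -> mdivides d s.

(* {s - d : s \in S}; an nmodType has no subtraction, so s - d is rendered as
   the c such that s = d + c, which is unique when M is cancellative. *)
Definition translate S d : M -> Prop := fun c => exists2 s, S s & s = d + c.

Definition is_mcd S d : Prop :=
  common_divisor S d /\
  forall e, common_divisor (translate S d) e -> invertible e.

Definition mcd_monoid : Prop :=
  forall A : {fset M}, A != fset0 -> exists d, is_mcd (fun s => s \in A) d.

End Monoids.

(* The multiplicative monoid R \ {0} of an integral domain R, seen as an
   nmodType: its + is the product of R and its 0 is the unit 1 of R. *)
Definition nonzero (R : comNzRingType) (domR : GRing.integral_domain_axiom R) :=
  {x : R | x != 0}.

Section Nonzero.
Variables (R : comNzRingType) (domR : GRing.integral_domain_axiom R).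
Local Notation T := (nonzero domR).

HB.instance Definition _ := SubChoice.on T.

Fact nonzero_mul_subproof (x y : T) : val x * val y != 0.
Proof.
by apply/negP=> /eqP/domR; rewrite (negbTE (valP x)) (negbTE (valP y)).
Qed.

Definition nonzero_one : T := Sub (1 : R) (oner_neq0 R).
Definition nonzero_mul (x y : T) : T := Sub (val x * val y) (nonzero_mul_subproof x y).

Fact nonzero_mulA : associative nonzero_mul.
Proof. by move=> x y z; apply/val_inj; rewrite /= mulrA. Qed.

Fact nonzero_mulC : commutative nonzero_mul.
Proof. by move=> x y; apply/val_inj; rewrite /= mulrC. Qed.

Fact nonzero_mul1 : left_id nonzero_one nonzero_mul.
Proof. by move=> x; apply/val_inj; rewrite /= mul1r. Qed.

HB.instance Definition _ :=
  GRing.isNmodule.Build T nonzero_mulA nonzero_mulC nonzero_mul1.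

End Nonzero.

Definition mcd_domain (R : comNzRingType) : Prop :=
  exists domR : GRing.integral_domain_axiom R, mcd_monoid (nonzero domR).

(* monalg only puts a ring structure on {malg R[K]} for a monomType K, which
   has no invertible element besides its identity. Since M may have nontrivial
   units, only the vector space {malg F[M]} of finitely supported functions
   M -> F is reused, and the product is defined here. *)
Definition monoid_algebra (F : fieldType) (M : nmodType) : Type := {malg F[M]}.

Section MonoidAlgebra.
Variables (F : fieldType) (M : nmodType).
Local Notation A := (monoid_algebra F M).
Implicit Types g : A.

HB.instance Definition _ := GRing.Lmodule.on A.

Definition ma_one : A := << 1 *g 0 >>.

Definition ma_mul g1 g2 : A :=
  \sum_(k1 <- msupp g1) \sum_(k2 <- msupp g2)
    << g1@_k1 * g2@_k2 *g k1 + k2 >>.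

Fact ma_mulEw (d1 d2 : {fset M}) g1 g2 :
  msupp g1 `<=` d1 -> msupp g2 `<=` d2 ->
  ma_mul g1 g2 =
    \sum_(k1 <- d1) \sum_(k2 <- d2) << g1@_k1 * g2@_k2 *g k1 + k2 >>.
Proof.
move=> le_d1 le_d2; rewrite /ma_mul (big_fset_incl _ le_d1) /=.
  apply/eq_bigr=> k1 _; apply/big_fset_incl => // k _ /mcoeff_outdom ->.
  by rewrite mulr0 monalgU0.
move=> k _ /mcoeff_outdom g1k.
by rewrite big1 => // k' _; rewrite g1k mul0r monalgU0.
Qed.

Fact ma_mulC : commutative ma_mul.
Proof.
move=> g1 g2; rewrite /ma_mul exchange_big /=.
by apply/eq_bigr=> k2 _; apply/eq_bigr=> k1 _; rewrite mulrC addrC.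
Qed.

Fact ma_mulDl : left_distributive ma_mul +%R.
Proof.
move=> g1 g2 g.
rewrite [in RHS](ma_mulEw (fsubsetUl _ (msupp g2)) (fsubset_refl _)).
rewrite [in RHS](ma_mulEw (fsubsetUr (msupp g1) _) (fsubset_refl _)).
rewrite (ma_mulEw (msuppD_le _ _) (fsubset_refl _)).
rewrite -big_split /=; apply/eq_bigr=> k1 _.
rewrite -big_split /=; apply/eq_bigr=> k2 _.
by rewrite mcoeffD mulrDl monalgUD.
Qed.

Fact ma_mulDr : right_distributive ma_mul +%R.
Proof. by move=> g g1 g2; rewrite ![ma_mul g _]ma_mulC ma_mulDl. Qed.

Fact ma_mul0g : left_zero 0 ma_mul.
Proof. by move=> g; rewrite /ma_mul msupp0 big_seq_fset0. Qed.

Fact ma_mulg0 : right_zero 0 ma_mul.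
Proof. by move=> g; rewrite ma_mulC ma_mul0g. Qed.

Fact ma_mulUg c k g :
  ma_mul << c *g k >> g = \sum_(k' <- msupp g) << c * g@_k' *g k + k' >>.
Proof.
rewrite (ma_mulEw msuppU_le (fsubset_refl _)) big_seq_fset1.
by apply/eq_bigr => k' _; rewrite mcoeffUU.
Qed.

Fact ma_mulUU c1 c2 k1 k2 :
  ma_mul << c1 *g k1 >> << c2 *g k2 >> = << c1 * c2 *g k1 + k2 >>.
Proof. by rewrite (ma_mulEw msuppU_le msuppU_le) !big_seq_fset1 !mcoeffUU. Qed.

Fact ma_mul1g : left_id ma_one ma_mul.
Proof.
move=> g; rewrite ma_mulUg [RHS]monalgE.
by apply/eq_bigr=> k _; rewrite mul1r add0r.
Qed.

Fact ma_mulA : associative ma_mul.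
Proof.
have suml I r (f : I -> A) g :
    ma_mul (\sum_(i <- r) f i) g = \sum_(i <- r) ma_mul (f i) g.
  by rewrite (big_morph (ma_mul^~ g) (fun x y => ma_mulDl x y g) (ma_mul0g g)).
have sumr I r (f : I -> A) g :
    ma_mul g (\sum_(i <- r) f i) = \sum_(i <- r) ma_mul g (f i).
  by rewrite (big_morph (ma_mul g) (ma_mulDr g) (ma_mulg0 g)).
have sumE g : g = \sum_(k <- msupp g) (<< g@_k *g k >> : A) by apply: monalgE.
move=> g1 g2 g3; rewrite (sumE g1) !suml; apply: eq_bigr => k1 _.
rewrite (sumE g2) suml !sumr suml; apply: eq_bigr => k2 _.
rewrite (sumE g3) !sumr; apply: eq_bigr => k3 _.
by rewrite !ma_mulUU mulrA addrA.
Qed.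

Fact ma_one_neq0 : ma_one != 0.
Proof. by rewrite monalgU_eq0 oner_eq0. Qed.

HB.instance Definition _ := GRing.Zmodule_isComNzRing.Build A
  ma_mulA ma_mulC ma_mul1g ma_mulDl ma_one_neq0.

Fact ma_scaleAl (c : F) (g1 g2 : A) : c *: (g1 * g2) = (c *: g1) * g2.
Proof.
have ZE (g : A) : c *: g = ma_mul << c *g 0 >> g.
  transitivity (fgscale c g) => //.
  by rewrite ma_mulUg; apply/eq_bigr=> k _; rewrite add0r.
by rewrite !ZE; apply: ma_mulA.
Qed.

HB.instance Definition _ := GRing.Lmodule_isLalgebra.Build F A ma_scaleAl.
HB.instance Definition _ := GRing.Lalgebra_isComAlgebra.Build F A.

End MonoidAlgebra.

(* Main.v *)
From HB Require Import structures.
Require Import Defs.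
From mathcomp Require Import all_boot all_order all_algebra finmap monalg generic_quotient zify.
From Stdlib Require Import Classical ClassicalEpsilon.

Set Implicit Arguments.
Unset Strict Implicit.
Unset Printing Implicit Defensive.

Import Order.TTheory GRing.Theory Num.Theory.
Local Open Scope fset_scope.
Local Open Scope ring_scope.

(* In a pre-Schreier monoid an MCD of a finite set is a gcd, so the monomials
   of F[M] have gcds, and primality of exponents gives Gauss' lemma for monomial
   contents. Inverting the monomials embeds F[M] in F[G], G the fraction group
   of M. A finite set of exponents lies in a free subgroup of finite rank of the
   torsion-free group G, so F[G] is flat over localizations of polynomial rings,
   and has gcds. By a Nagata-type criterion F[M] itself has gcds. *)

(** The group [G] need not be finitely generated, and a factor in F[G] can have exponents outside
    the subgroup spanned by those of the product: 1 - x = (1 - x^(1/2)) (1 + x^(1/2)). A gcd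
    computed in a finite-rank piece must therefore be shown to stay maximal in all of F[G]. This is
    what flatness is for. Coprimality of p and q is expressed as [p | q z] implies [p | z], which
    concerns the solutions of the linear equation p v = q u, and such statements survive flat
    extension.

    The Nagata-type criterion serves twice: with the nonzero constants of A it carries gcds from A
    to A[X], hence to iterated polynomial rings, and with the monomials it descends from F[G] to
    F[M]. Localizations are never formed in it; each statement about one is rendered by multipliers
    from the multiplicative set. Once F[M] has gcds, a gcd of a finite set of nonzero elements is an
    MCD. *)

(** * Divisibility, coprime cofactors and primality in a domain with gcds *)

Section Divisibility.
Variable R : comNzRingType.
Implicit Types x y z c d e : R.

Definition divides x y := exists z, y = x * z.

Definition has_gcds := forall x y, exists d,
  [/\ divides d x, divides d y
    & forall e, divides e x -> divides e y -> divides e d].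

Lemma divides_refl x : divides x x.
Proof. by exists 1; rewrite mulr1. Qed.

Lemma divides0 x : divides x 0.
Proof. by exists 0; rewrite mulr0. Qed.

Lemma divides_trans x y z : divides x y -> divides y z -> divides x z.
Proof. by move=> [u ->] [v ->]; exists (u * v); rewrite mulrA. Qed.

Lemma divides_mulr x y z : divides x y -> divides x (y * z).
Proof. by move=> [u ->]; exists (u * z); rewrite mulrA. Qed.

Lemma divides_mull x y z : divides x y -> divides x (z * y).
Proof. by rewrite mulrC; apply: divides_mulr. Qed.

Lemma dividesD x y z : divides x y -> divides x z -> divides x (y + z).
Proof. by move=> [u ->] [v ->]; exists (u + v); rewrite mulrDr. Qed.

Lemma dividesN x y : divides x y -> divides x (- y).
Proof. by move=> [u ->]; exists (- u); rewrite mulrN. Qed.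

Lemma dividesB x y z : divides x y -> divides x z -> divides x (y - z).
Proof. by move=> dxy dxz; apply: dividesD dxy (dividesN dxz). Qed.

Lemma divides_mul2l x y z : divides x y -> divides (z * x) (z * y).
Proof. by move=> [u ->]; exists u; rewrite mulrA. Qed.

Lemma divides_sum x (I : Type) (r : seq I) (P : pred I) (E : I -> R) :
  (forall i, P i -> divides x (E i)) -> divides x (\sum_(i <- r | P i) E i).
Proof.
move=> dE; elim/big_rec: _ => [|i y Pi dy]; first exact: divides0.
by apply: dividesD dy; apply: dE.
Qed.

Hypothesis domR : GRing.integral_domain_axiom R.

Lemma dom_mulI x : x != 0 -> injective ( *%R x).
Proof.
move=> nzx y z /eqP; rewrite -subr_eq0 -mulrBr => /eqP /domR.
by rewrite (negbTE nzx) /= subr_eq0 => /eqP.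
Qed.

Lemma dom_mulf_neq0 x y : x != 0 -> y != 0 -> x * y != 0.
Proof. by move=> nzx nzy; apply/eqP => /domR; apply/negP; rewrite negb_or nzx. Qed.

Lemma divides_mul2lP x y z : z != 0 -> divides (z * x) (z * y) -> divides x y.
Proof. by move=> nzz [u]; rewrite -mulrA => /(dom_mulI nzz) ->; exists u. Qed.

Hypothesis gcdR : has_gcds.

(** A gcd of [z * x'] and [z * y'] is a multiple [z * w] of [z]. Cancelling [z], [w] divides both
    cofactors, so [d * w] divides [x] and [y], hence [d], and [w] is a unit. As [x'] divides both
    [z * x'] and [y' * z], it divides [z * w], thus [z]. *)
Lemma gcd_cofactors x y : x != 0 -> exists d x' y',
  [/\ d != 0, x = d * x', y = d * y'
    & forall z, divides x' (y' * z) -> divides x' z].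
Proof.
move=> nzx; have [d [[x' Ex] [y' Ey] maxd]] := gcdR x y.
have nzd : d != 0 by apply: contraNneq nzx => d0; rewrite Ex d0 mul0r.
exists d, x', y'; split=> // z dvd_yz.
have [->|nzz] := eqVneq z 0; first exact: divides0.
have [g [gx gy maxg]] := gcdR (z * x') (z * y').
have [w Eg] : divides z g by apply: maxg; [exists x' | exists y'].
rewrite {}Eg in gx gy maxg.
have [v Ed] : divides (d * w) d.
  apply: maxd; [rewrite Ex|rewrite Ey]; apply: divides_mul2l.
    exact: divides_mul2lP gx.
  exact: divides_mul2lP gy.
have Ew : w * v = 1 by apply: (dom_mulI nzd); rewrite mulrA -Ed mulr1.
have x'g : divides x' (z * w).
  by apply: maxg; [apply: divides_mull; apply: divides_refl | rewrite mulrC].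
by rewrite -[z]mulr1 -Ew mulrA; apply: divides_mulr.
Qed.

(** For nonzero [c], take for [c1] a gcd of [c] and [x]: the cofactor of [c] is coprime to that of
    [x], so it divides [y]. *)
Lemma gcd_primal c x y : divides c (x * y) ->
  exists c1 c2, [/\ c = c1 * c2, divides c1 x & divides c2 y].
Proof.
have [->|nzc] := eqVneq c 0.
  case=> z; rewrite mul0r => /domR/orP[]/eqP->.
    by exists 0, 1; rewrite mulr1; split; [|exact: divides0|exists y; rewrite mul1r].
  by exists 1, 0; rewrite mulr0; split; [|exists x; rewrite mul1r|exact: divides0].
move=> cxy; have [d [c' [x' [nzd Ec Ex cop]]]] := gcd_cofactors x nzc.
exists d, c'; split=> //; first by exists x'.
apply: cop; apply: (@divides_mul2lP _ _ d) => //.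
by rewrite -Ec mulrA -Ex.
Qed.

Lemma gcd_seq (s : seq R) : exists d, (forall x, x \in s -> divides d x) /\
  forall e, (forall x, x \in s -> divides e x) -> divides e d.
Proof.
elim: s => [|x s [d [ds maxd]]]; first by exists 0; split=> // e _; apply: divides0.
have [g [gx gd maxg]] := gcdR x d; exists g; split=> [y|e es].
  by rewrite inE => /orP[/eqP->//|/ds]; apply: divides_trans.
apply: maxg; first by apply: es; rewrite mem_head.
by apply: maxd => y ys; apply: es; rewrite inE ys orbT.
Qed.

End Divisibility.

(** * Descent of gcds from a localization *)

Section GcdFromLocalization.
Variables (R : comNzRingType) (domR : GRing.integral_domain_axiom R).
Variable T : R -> Prop.
Hypothesis T_neq0 : forall t, T t -> t != 0.
Hypothesis T_mul : forall t u, T t -> T u -> T (t * u).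

Definition primitive x := forall t, T t -> divides t x -> divides t 1.

(* Nagata-type criterion: gcds in the localization of R at T, together with
   Gauss' lemma for T-contents, give gcds in R. *)
Lemma gcds_from_localization :
    (forall x y, x != 0 -> y != 0 -> exists t, [/\ T t, divides t x, divides t y
       & forall u, T u -> divides u x -> divides u y -> divides u t]) ->
    (forall x t y, primitive x -> x != 0 -> T t -> divides t (x * y) -> divides t y) ->
    (forall x y, x != 0 -> y != 0 -> exists d t u v,
       [/\ T t, T u, divides d (t * x) & divides d (u * y)] /\
       [/\ T v, d != 0 & forall e, divides e x -> divides e y ->
             exists w, T w /\ divides e (w * d)]) ->
  has_gcds R.
Proof.
move=> content gauss local_gcd x y.
have [->|nzx] := eqVneq x 0.
  by exists y; split=> //; [apply: divides0 | apply: divides_refl].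
have [->|nzy] := eqVneq y 0.
  by exists x; split=> //; [apply: divides_refl | apply: divides0].
have prim_part z : z != 0 -> exists t z',
    [/\ T t, z = t * z', z' != 0 & primitive z'].
  move=> nzz; have [t [Tt [z' Ez] _ maxt]] := content z z nzz nzz.
  exists t, z'; split=> //; first by apply: contraNneq nzz => E; rewrite Ez E mulr0.
  (* [t] is the greatest divisor of [z] from [T], and [t * u] is another one, so it divides [t] and
     [u] is a unit. *)
  move=> u Tu uz'; apply: (divides_mul2lP domR (T_neq0 Tt)).
  have utz : divides (t * u) z by rewrite Ez; apply: divides_mul2l.
  by rewrite mulr1; apply: maxt => //; apply: T_mul.
(* A primitive divisor of [z] in the localization divides [z] in R. *)
have descend a t z : primitive a -> a != 0 -> T t -> divides a (t * z) -> divides a z.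
  move=> prim_a nza Tt [h Eh].
  have [h' Eh'] : divides t h by apply: (gauss a) => //; rewrite -Eh; exists z.
  exists h'; apply: (dom_mulI domR (T_neq0 Tt)).
  by rewrite Eh Eh' mulrCA.
(* The local gcd divides [x] and [y] only up to multipliers from [T]; its primitive part [d0]
   divides them outright. The gcd is [d0] times the content [c]. *)
have [d [t [u [v [[Tt Tu dx dy] [Tv nzd maxd]]]]]] := local_gcd x y nzx nzy.
have [t1 [d0 [Tt1 Ed nzd0 prim_d0]]] := prim_part d nzd.
have d0d : divides d0 d by exists t1; rewrite Ed mulrC.
have [x0 Ex] : divides d0 x.
  by apply: (descend _ t) => //; apply: divides_trans d0d dx.
have [y0 Ey] : divides d0 y.
  by apply: (descend _ u) => //; apply: divides_trans d0d dy.
have [c [Tc cx cy maxc]] := content x y nzx nzy.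
exists (d0 * c); split.
- by rewrite Ex; apply: divides_mul2l; apply: (gauss d0); rewrite -?Ex.
- by rewrite Ey; apply: divides_mul2l; apply: (gauss d0); rewrite -?Ey.
move=> e ex ey.
have nze : e != 0 by apply: contraNneq nzx => e0; case: ex => h ->; rewrite e0 mul0r.
(* The two factors of [e] are bounded separately: the primitive [e0] divides [d0] by way of the
   localization, and [te], which lies in [T], divides [c]. *)
have [te [e0 [Tte Ee nze0 prim_e0]]] := prim_part e nze.
have e0e : divides e0 e by exists te; rewrite Ee mulrC.
have tee : divides te e by exists e0.
have [w [Tw ewd]] := maxd e ex ey.
have [z Ez] : divides e0 d0.
  apply: (descend _ (w * t1)) => //; first exact: T_mul.
  by rewrite -mulrA -Ed; apply: divides_trans e0e ewd.
have [c' Ec] : divides te c by apply: maxc => //; [apply: divides_trans ex | apply: divides_trans ey].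
by exists (z * c'); rewrite Ee Ez Ec mulrACA [e0 * te]mulrC.
Qed.

End GcdFromLocalization.

Lemma idomain_domain (A : idomainType) : GRing.integral_domain_axiom A.
Proof. by move=> x y /eqP; rewrite mulf_eq0. Qed.

Lemma field_has_gcds (F : fieldType) : has_gcds F.
Proof.
move=> x y; have [->|nzx] := eqVneq x 0.
  by exists y; split=> //; [apply: divides0 | apply: divides_refl].
exists x; split=> //; first exact: divides_refl.
by exists (x^-1 * y); rewrite mulrA divff // mul1r.
Qed.

(** * Gcds in polynomial rings over a domain with gcds *)

Section PolyGcd.
Variable A : idomainType.
Hypothesis gcdA : has_gcds A.
Implicit Types (c : A) (p q : {poly A}).

Let domA := @idomain_domain A.
Let domP := @idomain_domain {poly A}.

Lemma dividesCP c p : divides c%:P p <-> forall i, divides c p`_i.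
Proof.
split=> [[q ->] i|dvd_c]; first by rewrite coefCM; exists q`_i.
rewrite -[p]coefK poly_def; apply: divides_sum => i _.
have [z ->] := dvd_c i; rewrite -mul_polyC polyCM -mulrA.
by exists (z%:P * 'X^i).
Qed.

Definition const_poly p := exists2 c, c != 0 & p = c%:P.

Lemma divides_polyC c d : divides c%:P d%:P <-> divides c d.
Proof.
rewrite dividesCP; split=> [/(_ 0)|[z ->] i]; first by rewrite coefC.
by rewrite coefC; case: ifP => _; [exists z | apply: divides0].
Qed.

Lemma divides_lead_coef c p : divides c%:P p -> divides c (lead_coef p).
Proof. by move/dividesCP/(_ (size p).-1). Qed.

Lemma size_drop_lead p : p != 0 ->
  (size (p - (lead_coef p)%:P * 'X^((size p).-1))%R < size p)%N.
Proof.
move=> nzp; have sp : size p = (size p).-1.+1 by rewrite prednK ?size_poly_gt0.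
rewrite [X in (_ < X)%N]sp ltnS; apply/leq_sizeP => j le_j.
rewrite coefB coefCM coefXn; case: (ltngtP j (size p).-1) le_j => // [lt_j|->] _.
  rewrite mulr0 subr0 nth_default //; first by rewrite sp.
by rewrite mulr1 subrr.
Qed.

(** Primality of [c] applied to the product of the leading coefficients gives [c = c1 * c2] with
    [c1] dividing that of [p] and [c2] that of [q]. Dropping the leading term of [q] yields [c2 | q]
    by induction; after division by [c2], dropping the leading term of [p] yields [c1 | q'].
    Coprimality survives each step because the dropped term is divisible by the factor at hand. *)
Lemma poly_gauss_coprime c p q : c != 0 ->
    (forall u, divides u c -> divides u%:P p -> divides u 1) ->
  divides c%:P (p * q) -> divides c%:P q.
Proof.
have [n] := ubnP (size p + size q); elim: n c p q => // n IHn c p q le_n nzc cop.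
have [->|nzq] := eqVneq q 0; first by move=> _; apply: divides0.
have [p0|nzp] := eqVneq p 0.
  move=> _; have [z Ez] : divides c 1.
    by apply: cop; [apply: divides_refl | rewrite p0; apply: divides0].
  by exists (z%:P * q); rewrite mulrA -polyCM -Ez mul1r.
move=> cpq; have := divides_lead_coef cpq; rewrite lead_coefM.
case/(gcd_primal domA gcdA) => c1 [c2 [Ec c1p c2q]].
have [nzc1 nzc2] : c1 != 0 /\ c2 != 0 by apply/andP; rewrite -negb_or -mulf_eq0 -Ec.
have [c1c c2c] : divides c1 c /\ divides c2 c.
  by split; [exists c2 | exists c1; rewrite mulrC].
have c2pq : divides c2%:P (p * q).
  by apply: divides_trans cpq; apply/divides_polyC.
have [q' Eq] : divides c2%:P q.
  pose r := (lead_coef q)%:P * 'X^((size q).-1).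
  have c2r : divides c2%:P r by apply: divides_mulr; apply/divides_polyC.
  rewrite -[q](subrK r); apply: (dividesD _ c2r); apply: (IHn c2 p) => //.
  - by rewrite -ltnS; apply: leq_trans le_n; rewrite ltnS ltn_add2l; apply: size_drop_lead.
  - by move=> u uc2; apply: cop; apply: divides_trans uc2 c2c.
  - by rewrite mulrBr; apply: dividesB => //; apply: divides_mull.
rewrite Ec polyCM mulrC Eq; apply: divides_mul2l.
pose r := (lead_coef p)%:P * 'X^((size p).-1).
have c1r : divides c1%:P r by apply: divides_mulr; apply/divides_polyC.
apply: (IHn c1 (p - r)) => //.
  by move: (size_drop_lead nzp); rewrite -/r Eq mul_polyC size_scale // in le_n *; lia.
- move=> u uc1 ur; apply: cop; first exact: divides_trans c1c.
  rewrite -[p](subrK r); apply: dividesD ur _.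
  by apply: divides_trans c1r; apply/divides_polyC.
rewrite mulrBl; apply: dividesB; last exact: divides_mulr.
apply: (@divides_mul2lP _ domP _ _ c2%:P); first by rewrite polyC_eq0.
by rewrite mulrCA -Eq -polyCM [c2 * c1]mulrC -Ec.
Qed.

Lemma poly_has_gcds : has_gcds {poly A}.
Proof.
apply: (@gcds_from_localization _ domP const_poly).
- by move=> _ [c nzc ->]; rewrite polyC_eq0.
- by move=> _ _ [c nzc ->] [d nzd ->]; exists (c * d); rewrite ?mulf_neq0 ?polyCM.
(* The content is a gcd of all coefficients; [p] and [q] are read here as their coefficient
   lists. *)
- move=> p q nzp nzq; have [d [dpq maxd]] := gcd_seq gcdA (p ++ q).
  have dvd_seq c (r : {poly A}) : (forall x, x \in (r : seq A) -> divides c x) -> divides c%:P r.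
    move=> cr; apply/dividesCP => i; have [lt_i|ge_i] := ltnP i (size r).
      by apply: cr; apply: mem_nth.
    by rewrite nth_default //; apply: divides0.
  have dp : divides d%:P p by apply: dvd_seq => x xp; apply: dpq; rewrite mem_cat xp.
  exists d%:P; split=> //.
  + exists d => //; apply: contraNneq nzp => d0; case: dp => z ->.
    by rewrite d0 mul0r.
  + by apply: dvd_seq => x xq; apply: dpq; rewrite mem_cat xq orbT.
  move=> _ [c nzc ->] /dividesCP cp /dividesCP cq; apply/divides_polyC; apply: maxd => x.
  by rewrite mem_cat => /orP[]/(nthP 0)[i _ <-].
- move=> p _ q prim_p _ [c nzc ->]; apply: poly_gauss_coprime => // u uc up.
  apply/divides_polyC; apply: prim_p => //; exists u => //.
  by apply: contraNneq nzc => u0; case: uc => z ->; rewrite u0 mul0r.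
(* Over an integral domain [%|] is divisibility up to a nonzero constant factor, so [gcdp] is a gcd
   in the localization at the nonzero constants. *)
move=> p q nzp nzq; exists (gcdp p q).
have /Pdiv.Idomain.dvdpP[[c1 h1] /= nzc1 Eh1] := dvdp_gcdl p q.
have /Pdiv.Idomain.dvdpP[[c2 h2] /= nzc2 Eh2] := dvdp_gcdr p q.
exists c1%:P, c2%:P, 1; split; split.
- by exists c1.
- by exists c2.
- by rewrite mul_polyC Eh1; exists h1; rewrite mulrC.
- by rewrite mul_polyC Eh2; exists h2; rewrite mulrC.
- by exists 1; rewrite ?oner_eq0.
- by rewrite gcdp_eq0 negb_and nzp.
move=> e [x Ex] [y Ey].
have /Pdiv.Idomain.dvdpP[[c h] /= nzc Eh] : e %| gcdp p q.
  by rewrite dvdp_gcd Ex Ey !dvdp_mulr.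
by exists c%:P; split; [exists c | rewrite mul_polyC Eh; exists h; rewrite mulrC].
Qed.

End PolyGcd.

(** * Independent families in torsion-free abelian groups *)

Section IndependentFamilies.
Variable G : zmodType.
Implicit Types (k l : G).

Definition zspan n (t : 'I_n -> G) k := exists c : 'I_n -> int, k = \sum_i t i *~ c i.

Definition zindependent n (t : 'I_n -> G) :=
  forall c : 'I_n -> int, \sum_i t i *~ c i = 0 -> forall i, c i = 0.

Section Span.
Variables (n : nat) (t : 'I_n -> G).

Lemma zspan0 : zspan t 0.
Proof. by exists (fun=> 0); rewrite big1 // => i _; rewrite mulr0z. Qed.

Lemma zspanD k l : zspan t k -> zspan t l -> zspan t (k + l).
Proof.
move=> [c ->] [d ->]; exists (fun i => c i + d i).
by rewrite -big_split; apply: eq_bigr => i _; rewrite mulrzDr.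
Qed.

Lemma zspanMz k z : zspan t k -> zspan t (k *~ z).
Proof.
move=> [c ->]; exists (fun i => c i * z).
by rewrite mulrz_suml; apply: eq_bigr => i _; rewrite mulrzA.
Qed.

Lemma zspanN k : zspan t k -> zspan t (- k).
Proof. by move=> /(zspanMz (-1)); rewrite mulrNz mulr1z. Qed.

Lemma zspanB k l : zspan t k -> zspan t l -> zspan t (k - l).
Proof. by move=> sk sl; apply: zspanD sk (zspanN sl). Qed.

Lemma zspan_gen i : zspan t (t i).
Proof.
exists (fun j => (j == i)%:Z); rewrite (bigD1 i) //= eqxx mulr1z big1 ?addr0 // => j.
by move/negbTE->; rewrite mulr0z.
Qed.

End Span.

Lemma zspan_trans m n (t : 'I_m -> G) (u : 'I_n -> G) k :
  (forall i, zspan u (t i)) -> zspan t k -> zspan u k.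
Proof.
move=> tu [c ->]; elim/big_ind: _ => [||i _]; [exact: zspan0|exact: zspanD|].
exact: zspanMz.
Qed.

(** Distinct multiples of the first generator thus lie in distinct cosets of the span of the others,
    which will keep the powers of a new variable from interfering. *)
Lemma zindependent_lift n (t : 'I_n.+1 -> G) z : zindependent t ->
  zspan (t \o lift ord0) (t ord0 *~ z) -> z = 0.
Proof.
move=> ind_t [c Ec].
pose d i := if unlift ord0 i is Some j then - c j else z.
have /(_ ord0) : forall i, d i = 0; last by rewrite /d unlift_none.
apply: ind_t; rewrite big_ord_recl /d unlift_none Ec -big_split big1 // => i _ /=.
by rewrite liftK mulrNz subrr.
Qed.

Hypothesis tfG : torsion_free G.

Lemma torsion_free_mulrz k z : z != 0 -> k *~ z = 0 -> k = 0.
Proof.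
have pos (m : nat) : (0 < m)%N -> k *+ m = 0 -> k = 0.
  by move=> m_gt0 km; apply: (tfG m_gt0); rewrite km mul0rn.
case: z => m nzm; first by apply: pos; rewrite lt0n.
by rewrite NegzE mulrNz => /eqP; rewrite oppr_eq0 => /eqP; apply: pos.
Qed.

(* A Euclidean step on two nonzero coefficients of a relation lowers the sum of
   absolute values until a single coefficient, hence a zero generator, is left. *)
Lemma zspan_relation n (t : 'I_n.+1 -> G) (c : 'I_n.+1 -> int) i :
    c i != 0 -> \sum_j t j *~ c j = 0 ->
  exists u : 'I_n -> G, forall j, zspan u (t j).
Proof.
have [N] := ubnP (\sum_j `|c j|)%N; elim: N => // N IHN in t c i *.
move=> le_N nzi rel.
have [/existsP[j /andP[nji nzj]]|no_j] := boolP [exists j, (j != i) && (c j != 0)]; last first.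
  have ti0 : t i = 0.
    apply: (torsion_free_mulrz nzi); rewrite -rel (bigD1 i) //= big1 ?addr0 // => j nji.
    move: no_j; rewrite negb_exists => /forallP/(_ j).
    by rewrite nji negbK => /eqP->; rewrite mulr0z.
  exists (t \o lift i) => j; case: (unliftP i j) => [l ->|->].
    exact: (zspan_gen (t \o lift i)).
  by rewrite ti0; apply: zspan0.
wlog le_ji : i j nzi nzj nji / (`|c j| <= `|c i|)%N.
  move=> wlog_ji; case/orP: (leq_total `|c j| `|c i|) => [|le_ij]; first exact: wlog_ji nzi nzj nji.
  by apply: (wlog_ji j i) le_ij => //; rewrite eq_sym.
(* [s] is 1 or -1, chosen so that [s * c j] has the sign of [c i]; as 0 < |c j| <= |c i|, the
   subtraction strictly lowers |c i|. *)
have [s lt_s] : exists s : int, (`|(c i - s * c j)%R| < `|c i|)%N.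
  case: (lerP 0 (c i * c j)) => sgn; [exists 1|exists (-1)]; nia.
(* Adding [s] times [t i] to [t j] compensates for the change of [c i], so the relation persists.
   The operation is invertible, so the span is kept. *)
pose t' (l : 'I_n.+1) := if l == j then t j + t i *~ s else t l.
pose c' (l : 'I_n.+1) := if l == i then c i - s * c j else c l.
have [|||u ut'] := IHN t' c' j.
- rewrite -ltnS; apply: leq_trans le_N; rewrite ltnS.
  rewrite (bigD1 i) // [X in (_ < X)%N](bigD1 i) //= /c' eqxx -addSn leq_add //.
  by rewrite leq_eqVlt; apply/orP; left; apply/eqP/eq_bigr => l /negbTE->.
- by rewrite /c' (negbTE nji).
- rewrite -[RHS]rel (bigD1 i) // (bigD1 j) //= [RHS](bigD1 i) // [in RHS](bigD1 j) //=.
  rewrite /t' /c' !eqxx (negbTE nji) eq_sym (negbTE nji) !addrA; congr (_ + _).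
    rewrite mulrzBr mulrzDl -mulrzA -!addrA; congr (_ + _).
    by rewrite addrC -addrA subrr addr0.
  by apply: eq_bigr => l /andP[/negbTE-> /negbTE->].
exists u => l; have := ut' l; rewrite {1}/t'; case: eqP => [-> utj|//].
rewrite -[t j](addrK (t i *~ s)); apply: zspanB utj _; apply: zspanMz.
by have := ut' i; rewrite /t' eq_sym (negbTE nji).
Qed.

(** A dependent family lies in the span of a family with one member fewer, so induction on [n] ends
    at an independent one. The family [u] is only asked to span [t], not to lie in its span. *)
Lemma zindependent_refinement n (t : 'I_n -> G) :
  exists m (u : 'I_m -> G), zindependent u /\ forall i, zspan u (t i).
Proof.
elim: n t => [|n IHn] t.
  by exists 0%N, t; split=> [c _|] [].
have [ind_t|] := classic (zindependent t).
  by exists n.+1, t; split=> // i; apply: zspan_gen.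
move=> dep; have [c Hc] := not_all_ex_not _ _ dep; have [rel nc0] := imply_to_and _ _ Hc.
have [i /eqP nzi] := not_all_ex_not _ _ nc0.
have [u ut] := zspan_relation nzi rel.
have [m [v [ind_v vu]]] := IHn u.
by exists m, v; split=> // j; apply: zspan_trans (ut j).
Qed.

Lemma zindependent_seq (s : seq G) :
  exists n (t : 'I_n -> G), zindependent t /\ forall k, k \in s -> zspan t k.
Proof.
have [n [t [ind_t st]]] := zindependent_refinement (fun i : 'I_(size s) => s`_i).
exists n, t; split=> // k /(nthP 0)[i lt_i <-]; exact: (st (Ordinal lt_i)).
Qed.

End IndependentFamilies.

(** * Supports, coefficients and monomial divisibility in F[M] *)

Section Monomials.
Variables (F : fieldType) (M : nmodType).
Local Notation A := (monoid_algebra F M).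
Implicit Types (a b : F) (k l m : M) (f g : A).

Definition mono a k : A := << a *g k >>.

Lemma monoM a b k l : mono a k * mono b l = mono (a * b) (k + l).
Proof. exact: ma_mulUU. Qed.

Lemma mono10 : mono 1 0 = 1.
Proof. by []. Qed.

Lemma mono_eq0 a k : (mono a k == 0) = (a == 0).
Proof. exact: monalgU_eq0. Qed.

Lemma mono1_neq0 k : mono 1 k != 0.
Proof. by rewrite mono_eq0 oner_eq0. Qed.

Lemma coeff_mono a k l : (mono a k)@_l = if k == l then a else 0.
Proof. by rewrite mcoeffU; case: eqP. Qed.

Lemma msupp_mono1 k l : (l \in msupp (mono 1 k)) = (l == k).
Proof. by rewrite msuppU oner_eq0 inE. Qed.

Lemma coeffD f g k : (f + g)@_k = f@_k + g@_k.
Proof. exact: mcoeffD. Qed.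

Lemma coeffN f k : (- f)@_k = - f@_k.
Proof. exact: mcoeffN. Qed.

Lemma coeff0 k : (0 : A)@_k = 0.
Proof. exact: mcoeff0. Qed.

Lemma coeff_sum I (r : seq I) (P : pred I) (E : I -> A) k :
  (\sum_(i <- r | P i) E i)@_k = \sum_(i <- r | P i) (E i)@_k.
Proof.
by apply: (big_morph (fun f : A => f@_k)) => [f g|]; rewrite ?coeffD ?coeff0.
Qed.

Lemma monoid_algebraP f g : (forall k, f@_k = g@_k) -> f = g.
Proof. by move/malgP. Qed.

Lemma msupp_neq0 f : f != 0 -> exists k, k \in msupp f.
Proof.
move=> nzf; apply: NNPP => no_k; case/eqP: nzf; apply: monoid_algebraP => k.
by rewrite coeff0; apply: mcoeff_outdom; apply/negP => kf; apply: no_k; exists k.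
Qed.

Lemma mono_sum f : f = \sum_(k <- msupp f) mono f@_k k.
Proof. exact: monalgE. Qed.

Lemma monoid_algebra_ind (P : A -> Prop) f :
    P 0 -> (forall f1 f2, P f1 -> P f2 -> P (f1 + f2)) ->
    (forall k, k \in msupp f -> P (mono f@_k k)) ->
  P f.
Proof.
move=> P0 PD Pmono; rewrite [f]mono_sum big_seq_cond.
by apply: big_ind => // k /andP[kf _]; apply: Pmono.
Qed.

Lemma msupp_sum_exists (I : eqType) (r : seq I) (P : pred I) (E : I -> A) k :
  k \in msupp (\sum_(i <- r | P i) E i) ->
  exists i, [/\ i \in r, P i & k \in msupp (E i)].
Proof.
rewrite -mcoeff_neq0 coeff_sum => nz.
have [/hasP[i ir /andP[Pi kE]]|no_i] := boolP (has (fun i => P i && (k \in msupp (E i))) r).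
  by exists i.
case/eqP: nz; rewrite big_seq_cond big1 // => i /andP[ir Pi].
apply: mcoeff_outdom; apply: contra no_i => kE; apply/hasP; exists i => //.
by rewrite Pi.
Qed.

Lemma msuppM_exists f g k : k \in msupp (f * g) ->
  exists l m, [/\ l \in msupp f, m \in msupp g & k = l + m].
Proof.
rewrite [f]mono_sum big_distrl => /msupp_sum_exists[l [lf _]].
rewrite [g]mono_sum big_distrr => /msupp_sum_exists[m [mg _]].
rewrite /= monoM => /(fsubsetP (msuppU_le)); rewrite inE => /eqP ->.
by exists l, m; rewrite -!mono_sum.
Qed.

Hypothesis cancM : cancellative M.

Lemma coeff_monoM a m f k : (mono a m * f)@_(m + k) = a * f@_k.
Proof.
rewrite {1}[f]mono_sum big_distrr coeff_sum /=.
under eq_bigr => l _ do rewrite monoM coeff_mono.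
have [kf|kNf] := boolP (k \in msupp f).
  rewrite (big_fsetD1 k) //= eqxx big1_seq ?addr0 // => l /andP[_].
  rewrite !inE => /andP[nlk _]; case: eqP => // /cancM lk; by rewrite lk eqxx in nlk.
rewrite (mcoeff_outdom kNf) mulr0 big1_seq // => l /andP[_ lf].
by case: eqP => // /cancM lk; rewrite -lk lf in kNf.
Qed.

Lemma divides_monoP m f :
  divides (mono 1 m) f <-> forall k, k \in msupp f -> mdivides m k.
Proof.
split=> [[g ->] k /msuppM_exists[l [c [lm _ ->]]]|dvd_m].
  by move: lm; rewrite msupp_mono1 => /eqP->; exists c.
apply: monoid_algebra_ind => [|f1 f2|k /dvd_m[c Ek]].
- exact: divides0.
- exact: dividesD.
by exists (mono f@_k c); rewrite monoM mul1r Ek.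
Qed.

Lemma divides_mono k l : divides (mono 1 k) (mono 1 l) <-> mdivides k l.
Proof.
rewrite divides_monoP; split=> [|kl j]; first by apply; rewrite msupp_mono1.
by rewrite msupp_mono1 => /eqP->.
Qed.

End Monomials.

(** * The embedding of monoid algebras induced by an injective morphism of exponents *)

Section MapExponents.
Variables (F : fieldType) (M N : nmodType) (h : M -> N).
Hypotheses (hD : forall k l, h (k + l) = h k + h l) (h_inj : injective h).
Implicit Types f g : monoid_algebra F M.

Definition map_exp f : monoid_algebra F N := \sum_(k <- msupp f) mono f@_k (h k).

Lemma coeff_map_exp f k : (map_exp f)@_(h k) = f@_k.
Proof.
rewrite coeff_sum; under eq_bigr => l _ do rewrite coeff_mono (inj_eq h_inj).
have [kf|kNf] := boolP (k \in msupp f).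
  rewrite (big_fsetD1 k) //= eqxx big1_seq ?addr0 // => l /andP[_].
  by rewrite !inE => /andP[/negbTE->].
rewrite (mcoeff_outdom kNf) big1_seq // => l /andP[_ lf].
by case: eqP => // lk; rewrite -lk lf in kNf.
Qed.

Lemma coeff_map_exp_notin f l : (forall k, l <> h k) -> (map_exp f)@_l = 0.
Proof.
move=> lNh; rewrite coeff_sum big1 // => k _; rewrite coeff_mono.
by case: eqP => // E; case: (lNh k).
Qed.

Lemma map_exp_inj : injective map_exp.
Proof.
by move=> f g E; apply: monoid_algebraP => k; rewrite -!coeff_map_exp E.
Qed.

Lemma map_expD f g : map_exp (f + g) = map_exp f + map_exp g.
Proof.
apply: monoid_algebraP => l; rewrite coeffD.
have [[k ->]|lNh] := classic (exists k, l = h k); first by rewrite !coeff_map_exp coeffD.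
by rewrite !coeff_map_exp_notin ?addr0 // => k lk; apply: lNh; exists k.
Qed.

Lemma map_exp0 : map_exp 0 = 0.
Proof. by rewrite /map_exp msupp0 big_seq_fset0. Qed.

Lemma map_exp_mono a k : map_exp (mono a k) = mono a (h k).
Proof.
apply: monoid_algebraP => l.
have [[j ->]|lNh] := classic (exists j, l = h j).
  by rewrite coeff_map_exp !coeff_mono (inj_eq h_inj).
rewrite coeff_map_exp_notin ?coeff_mono => [|j lj]; last by apply: lNh; exists j.
by case: eqP => // lk; case: lNh; exists k.
Qed.

Lemma map_expM f g : map_exp (f * g) = map_exp f * map_exp g.
Proof.
apply: (@monoid_algebra_ind F M (fun f => map_exp (f * g) = _ f * _)) => [|f1 f2 E1 E2|k _].
- by rewrite mul0r map_exp0 mul0r.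
- by rewrite mulrDl !map_expD E1 E2 mulrDl.
apply: (@monoid_algebra_ind F M (fun g => map_exp (_ * g) = _ * map_exp g)) => [|g1 g2 E1 E2|l _].
- by rewrite mulr0 map_exp0 mulr0.
- by rewrite mulrDr !map_expD E1 E2 mulrDr.
by rewrite monoM !map_exp_mono monoM hD.
Qed.

End MapExponents.

(** * Group algebras of torsion-free groups: polynomial models, flatness, gcds *)

Section LaurentModel.
Variables (F : fieldType) (G : zmodType).
Local Notation FG := (monoid_algebra F G).
Implicit Types (f g : FG) (k l : G).

Lemma zmod_cancellative : cancellative G.
Proof. by move=> a b c /addrI. Qed.

Let cancG := zmod_cancellative.

Lemma monoV k : mono (1 : F) k * mono (1 : F) (- k) = 1.
Proof. by rewrite monoM mulr1 subrr. Qed.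

Lemma monoVK k f : mono (1 : F) (- k) * (mono (1 : F) k * f) = f.
Proof. by rewrite mulrA [_ * mono _ k]mulrC monoV mul1r. Qed.

Lemma monoKV k f : mono (1 : F) k * (mono (1 : F) (- k) * f) = f.
Proof. by rewrite mulrA monoV mul1r. Qed.

(* F[Z^n] is realized, up to inverting the variables, by an iterated
   polynomial ring A mapping its variables to the monomials of exponent t i. *)
Definition laurent_model n (t : 'I_n -> G) (A : idomainType) (phi : {rmorphism A -> FG}) :=
  [/\ has_gcds A, forall p, phi p = 0 -> p = 0,
      forall p k, k \in msupp (phi p) -> zspan t k,
      forall i, exists p, phi p = mono (1 : F) (t i)
    & forall a, exists p, phi p = mono a 0].

Lemma laurent_model_nil (t : 'I_0 -> G) : laurent_model t (in_alg FG).
Proof.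
split=> [|a /eqP|a k|[]//|a]; first exact: field_has_gcds.
- by rewrite scaler_eq0 oner_eq0 orbF => /eqP.
- rewrite -mcoeff_neq0 mcoeffZ -mono10 coeff_mono; have [<- _|_] := eqVneq 0 k.
    exact: zspan0.
  by rewrite mulr0 eqxx.
exists a; apply: monoid_algebraP => k.
by rewrite mcoeffZ -mono10 !coeff_mono; case: eqP; rewrite ?mulr1 ?mulr0.
Qed.

Section Step.
Variables (n : nat) (t : 'I_n.+1 -> G) (A : idomainType) (phi : {rmorphism A -> FG}).
Hypothesis ind_t : zindependent t.
Hypothesis model : laurent_model (t \o lift ord0) phi.
Let x := mono (1 : F) (t ord0).

Let comm_x : commr_rmorph phi x.
Proof. by move=> a; apply: mulrC. Qed.

Lemma monoXn k i : mono (1 : F) k ^+ i = mono (1 : F) (k *+ i).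
Proof. by elim: i => // i IHi; rewrite exprS IHi monoM mulr1 mulrS. Qed.

Lemma horner_morph_mono p :
  horner_morph comm_x p = \sum_(i < size p) mono (1 : F) (t ord0 *+ i) * phi p`_i.
Proof.
rewrite /horner_morph (horner_coef_wide _ (size_poly _ _)).
by apply: eq_bigr => i _; rewrite coef_map monoXn mulrC.
Qed.

Lemma zspan_lift k : zspan (t \o lift ord0) k -> zspan t k.
Proof. by apply: zspan_trans => i; apply: zspan_gen. Qed.

(** The variable goes to [x]. For injectivity, the images of the terms of different degrees are
    supported in distinct cosets of the span of the remaining generators, so no exponent coming from
    the leading coefficient can be cancelled by another term. *)
Lemma laurent_model_cons : laurent_model t (horner_morph comm_x).
Proof.
have [gcdA inj_phi span_phi var_phi const_phi] := model; split.
- exact: poly_has_gcds.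
- move=> p /= /eqP; rewrite horner_morph_mono => /eqP E0.
  apply/eqP; apply: contraT => nzp.
  have s_gt0 : (0 < size p)%N by rewrite size_poly_gt0.
  have lt_d : ((size p).-1 < size p)%N by rewrite prednK.
  pose d := Ordinal lt_d.
  have nz : phi p`_d != 0.
    by apply/eqP => /inj_phi /eqP; rewrite -[p`_d]/(lead_coef p) lead_coef_eq0 (negbTE nzp).
  have [k kd] := msupp_neq0 nz.
  move/(congr1 (fun f : FG => f@_(t ord0 *+ d + k))): E0.
  rewrite coeff_sum coeff0 (bigD1 d) //= coeff_monoM // mul1r big1 ?addr0.
    by move/eqP; rewrite mcoeff_eq0 kd.
  move=> i nid; apply/eqP; rewrite mcoeff_eq0; apply/negP => /msuppM_exists[l [m [+ mi]]].
  rewrite msupp_mono1 => /eqP-> E.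
  have : i%:Z - d%:Z = 0.
    apply: (zindependent_lift ind_t); rewrite mulrzBr -!pmulrn.
    have -> : t ord0 *+ i - t ord0 *+ d = k - m.
      by apply/eqP; rewrite subr_eq addrAC eq_sym subr_eq [k + _]addrC E.
    by apply: zspanB; apply: span_phi; [exact: kd | exact: mi].
  move/eqP; rewrite subr_eq0 => /eqP[E']; case/eqP: nid; exact: val_inj.
- move=> p k /=; rewrite horner_morph_mono => /msupp_sum_exists[i [_ _]].
  case/msuppM_exists=> l [m [+ mi ->]]; rewrite msupp_mono1 => /eqP->.
  apply: zspanD; last by apply: zspan_lift; apply: span_phi mi.
  by rewrite pmulrn; apply: zspanMz; apply: zspan_gen.
- move=> i; case: (unliftP ord0 i) => [j ->|->]; last first.
    by exists 'X; rewrite /= horner_morphX.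
  have [p Ep] := var_phi j.
  by exists p%:P; rewrite /= horner_morphC.
move=> a; have [p Ep] := const_phi a.
by exists p%:P; rewrite /= horner_morphC.
Qed.

End Step.

Lemma laurent_model_exists n (t : 'I_n -> G) : zindependent t ->
  exists (A : idomainType) (phi : {rmorphism A -> FG}), laurent_model t phi.
Proof.
elim: n t => [|n IHn] t ind_t.
  by exists F, (in_alg FG); apply: laurent_model_nil.
have [c ind_c|A [phi model]] := IHn (t \o lift ord0).
  move=> i; pose d j := if unlift ord0 j is Some l then c l else 0.
  have := ind_t d _ (lift ord0 i); rewrite /d liftK; apply.
  rewrite big_ord_recl unlift_none mulr0z add0r -[RHS]ind_c.
  by apply: eq_bigr => l _; rewrite liftK.
by exists {poly A}; eexists; apply: laurent_model_cons ind_t model.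
Qed.

Section InModel.
Variables (n : nat) (t : 'I_n -> G) (A : idomainType) (phi : {rmorphism A -> FG}).
Hypothesis model : laurent_model t phi.

(** This is the localization of the image of [phi] at the monomials it contains: [f] is the fraction
    of [phi p] by [phi s]. The preimage [s] of the denominator is recorded so that equations between
    fractions can be cleared inside [A]. *)
Definition in_model f := exists s k p, phi s = mono (1 : F) k /\ phi p = mono (1 : F) k * f.

Lemma in_modelD f g : in_model f -> in_model g -> in_model (f + g).
Proof.
move=> [s [k [p [Es Ep]]]] [r [l [q [Er Eq]]]].
exists (s * r), (k + l), (r * p + s * q).
have Ekl : mono (1 : F) (k + l) = mono 1 k * mono 1 l by rewrite monoM mulr1.
split; first by rewrite rmorphM Es Er Ekl.
by rewrite rmorphD 2!rmorphM Es Er Ep Eq Ekl mulrDr -!mulrA [in RHS]mulrCA.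
Qed.

Lemma in_modelM f g : in_model f -> in_model g -> in_model (f * g).
Proof.
move=> [s [k [p [Es Ep]]]] [r [l [q [Er Eq]]]].
exists (s * r), (k + l), (p * q).
by rewrite !rmorphM Es Er Ep Eq mulrACA monoM mulr1.
Qed.

Lemma in_model_phi p : in_model (phi p).
Proof. by exists 1, 0, p; rewrite rmorph1 mono10 mul1r. Qed.

Lemma in_model_mono k : zspan t k -> in_model (mono (1 : F) k).
Proof.
have [_ _ _ var_phi _] := model.
have M1 l m : in_model (mono (1 : F) l) -> in_model (mono (1 : F) m) -> in_model (mono (1 : F) (l + m)).
  by move=> il im; rewrite -[1]mulr1 -monoM; apply: in_modelM.
have M0 : in_model (mono (1 : F) 0) by rewrite mono10 -(rmorph1 phi); apply: in_model_phi.
have Mn l m : in_model (mono (1 : F) l) -> in_model (mono (1 : F) (l *+ m)).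
  by move=> il; elim: m => [|m IHm]; [rewrite mulr0n | rewrite mulrS; apply: M1].
case=> c ->; apply: (big_ind (fun l => in_model (mono (1 : F) l))) => // i _.
have [p Ep] := var_phi i.
case: (c i) => m; first by rewrite -pmulrn; apply: Mn; rewrite -Ep; apply: in_model_phi.
rewrite NegzE mulrNz -mulNrz -pmulrn; apply: Mn.
(* The inverse of a variable has that variable as denominator and 1 as numerator. *)
by exists p, (t i), 1; rewrite Ep rmorph1 monoV.
Qed.

Lemma in_model_msupp f : (forall k, k \in msupp f -> zspan t k) -> in_model f.
Proof.
have [_ _ _ _ const_phi] := model.
move=> sf; apply: monoid_algebra_ind => [||k kf].
- by rewrite -(rmorph0 phi); apply: in_model_phi.
- exact: in_modelD.
have [p Ep] := const_phi f@_k.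
rewrite -[f@_k]mulr1 -[k]add0r -monoM add0r -Ep; apply: in_modelM.
  exact: in_model_phi.
by apply: in_model_mono; apply: sf.
Qed.

End InModel.

Section Flatness.
Variables (n : nat) (t : 'I_n -> G) (A : idomainType) (phi : {rmorphism A -> FG}).
Hypothesis model : laurent_model t phi.

Definition restrict (P : pred G) f : FG := \sum_(k <- msupp f | P k) mono f@_k k.

Lemma coeff_restrict (P : pred G) f k : (restrict P f)@_k = if P k then f@_k else 0.
Proof.
rewrite coeff_sum big_mkcond /=; under eq_bigr => l _ do rewrite coeff_mono.
have [kf|kNf] := boolP (k \in msupp f).
  rewrite (big_fsetD1 k) //= eqxx big1_seq ?addr0 // => l /andP[_].
  by rewrite !inE => /andP[/negbTE-> _]; rewrite if_same.
rewrite (mcoeff_outdom kNf) if_same big1_seq // => l /andP[_ lf].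
by case: eqP => [lk|_]; rewrite ?if_same //; rewrite -lk lf in kNf.
Qed.

Lemma restrictD (P : pred G) f g : restrict P (f + g) = restrict P f + restrict P g.
Proof.
by apply: monoid_algebraP => k; rewrite coeffD !coeff_restrict coeffD; case: ifP; rewrite ?addr0.
Qed.

Lemma restrict0 (P : pred G) : restrict P 0 = 0.
Proof. by apply: monoid_algebraP => k; rewrite coeff_restrict !coeff0 if_same. Qed.

Lemma restrict_mono (P : pred G) a k : restrict P (mono a k) = if P k then mono a k else 0.
Proof.
apply: monoid_algebraP => l; rewrite coeff_restrict.
case: (boolP (P k)) => Pk; rewrite !(coeff_mono, coeff0).
  by case: eqP => [<-|]; rewrite ?Pk ?if_same.
by case: eqP => [<-|]; rewrite ?(negbTE Pk) ?if_same.
Qed.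

(** The intended [P] is a coset of a subgroup containing the exponents of [f]: multiplication by [f]
    maps the coset and its complement to themselves, so the projection onto the coset is linear over
    such [f]. *)
Lemma restrict_mul (P : pred G) f g :
    (forall l k, l \in msupp f -> P (l + k) = P k) ->
  restrict P (f * g) = f * restrict P g.
Proof.
move=> invP.
apply: (@monoid_algebra_ind F G (fun g => restrict P (f * g) = f * restrict P g))
    => [|g1 g2 E1 E2|k _].
- by rewrite mulr0 restrict0 mulr0.
- by rewrite mulrDr !restrictD E1 E2 mulrDr.
pose b := g@_k; rewrite -/b.
apply: (@monoid_algebra_ind F G (fun f => restrict P (f * mono b k) = f * restrict P _) f)
    => [|f1 f2 E1 E2|l lf].
- by rewrite !mul0r restrict0.
- by rewrite !mulrDl restrictD E1 E2.
rewrite monoM !restrict_mono (invP _ _ lf); case: ifP => _; first by rewrite monoM.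
by rewrite mulr0.
Qed.

(* F[G] is flat over A: split along the cosets of the span of t. *)
Lemma model_flat p q u v :
    (forall z, divides p (q * z) -> divides p z) ->
  phi p * v = phi q * u -> divides (phi p) u.
Proof.
move=> cop; have [N] := ubnP #|` msupp u|; elim: N u v => // N IHN u v le_N Euv.
have [->|nzu] := eqVneq u 0; first exact: divides0.
have [gcdA inj_phi span_phi _ _] := model.
have [k ku] := msupp_neq0 nzu.
pose P l : bool := excluded_middle_informative (zspan t (l - k)).
have PP l : P l <-> zspan t (l - k).
  by rewrite /P; case: excluded_middle_informative.
have invP r l m : l \in msupp (phi r) -> P (l + m) = P m.
  move/span_phi => sl; apply/idP/idP => /PP sm; apply/PP.
    by have := zspanB sm sl; rewrite addrAC [l + m]addrC addrK.
  by rewrite -addrA; apply: zspanD.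
have EuvP : phi p * restrict P v = phi q * restrict P u.
  by rewrite -!restrict_mul ?Euv // => l m; apply: invP.
(* Translating the coset of [k] by [- k] moves it onto the span of [t], where fractions from [A] are
   available. *)
have in_model_coset w : in_model phi (mono 1 (- k) * restrict P w).
  apply: (in_model_msupp model) => _ /msuppM_exists[l [m [+ + ->]]].
  rewrite msupp_mono1 => /eqP->; rewrite -mcoeff_neq0 coeff_restrict.
  have [/PP sl _|_] := boolP (P m); last by rewrite eqxx.
  by rewrite addrC.
have [s [a [v1 [Es Ev1]]]] := in_model_coset v.
have [r [b [u1 [Er Eu1]]]] := in_model_coset u.
have div_coset : divides (phi p) (restrict P u).
  (* The denominators are crossed, [s] belonging to [v1] and [r] to [u1], so that the equation reads
     [p * (r * v1) = q * (s * u1)] in [A], where coprimality applies. The remaining monomials are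
     units of F[G]. *)
  have [z Ez] : divides p (s * u1).
    apply: cop; exists (r * v1); apply/eqP; rewrite -subr_eq0; apply/eqP/inj_phi.
    rewrite rmorphB 4!rmorphM Es Er Ev1 Eu1; apply/eqP; rewrite subr_eq0; apply/eqP.
    have shuffle (R : comNzRingType) (c d x y z g h : R) :
        c * g = d * h -> d * (x * (y * (z * h))) = c * (y * (x * (z * g))).
      move=> E; rewrite [LHS]mulrCA [d * _]mulrCA [d * _]mulrCA -E.
      by rewrite [RHS]mulrCA [X in _ = _ * X]mulrCA [X in _ = _ * (_ * X)]mulrCA mulrCA.
    exact: shuffle.
  have : divides (phi p) (mono 1 a * (mono 1 b * (mono 1 (- k) * restrict P u))).
    by rewrite -Eu1 -Es -rmorphM Ez rmorphM; exists (phi z).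
  move/(divides_mull (mono 1 (- a))); rewrite monoVK.
  move/(divides_mull (mono 1 (- b))); rewrite monoVK.
  by move/(divides_mull (mono 1 k)); rewrite monoKV.
rewrite -[u](subrK (restrict P u)); apply: (dividesD _ div_coset).
(* Subtracting the coset part removes at least [k] from the support of [u]. *)
apply: (IHN _ (v - restrict P v)); last by rewrite !mulrBr Euv EuvP.
rewrite -ltnS; apply: leq_trans le_N; rewrite ltnS; apply: fproper_ltn_card.
rewrite fproperE; apply/andP; split.
  apply/fsubsetP => l; rewrite -!mcoeff_neq0 coeffD coeffN coeff_restrict.
  by case: ifP => _; rewrite ?subrr ?subr0 ?eqxx.
apply/negP => /fsubsetP/(_ k ku); rewrite -mcoeff_neq0 coeffD coeffN coeff_restrict.
have -> : P k by apply/PP; rewrite subrr; apply: zspan0.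
by rewrite subrr eqxx.
Qed.

End Flatness.

Hypothesis tfG : torsion_free G.

Lemma model_of_pair f g :
  exists n (t : 'I_n -> G) (A : idomainType) (phi : {rmorphism A -> FG}),
    [/\ laurent_model t phi, in_model phi f & in_model phi g].
Proof.
have [n [t [ind_t st]]] := zindependent_seq tfG (msupp f ++ msupp g).
have [A [phi model]] := laurent_model_exists ind_t.
exists n, t, A, phi; split=> //; apply: (in_model_msupp model) => k kfg; apply: st.
  by rewrite mem_cat kfg.
by rewrite mem_cat kfg orbT.
Qed.

(** Up to monomials, which are units, both factors lie in the image of one integral domain [A] on
    which [phi] is injective. *)
Lemma group_algebra_domain : GRing.integral_domain_axiom FG.
Proof.
move=> f g fg0; have [n [t [A [phi [model]]]]] := model_of_pair f g.
have [_ inj_phi _ _ _] := model.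
move=> [s [k [p [_ Ep]]]] [r [l [q [_ Eq]]]].
have /eqP : p * q = 0.
  by apply: inj_phi; rewrite rmorphM Ep Eq mulrACA fg0 mulr0.
rewrite mulf_eq0 => /orP[] /eqP pq0; apply/orP; [left|right]; apply/eqP.
  by rewrite -[f](monoVK k) -Ep pq0 rmorph0 mulr0.
by rewrite -[g](monoVK l) -Eq pq0 rmorph0 mulr0.
Qed.

Let domFG := group_algebra_domain.

(** Maximality of [d] inside [A] does not reach a common divisor [e] lying outside the model, so it
    is replaced by coprimality of the cofactors: from [phi p = e * u] and [phi q = e * v] one gets
    [phi p' * v = phi q' * u]. Flatness gives [u = phi p' * w], and cancelling [phi p'] leaves
    [phi d = e * w]. *)
Lemma group_algebra_has_gcds : has_gcds FG.
Proof.
move=> f g; have [->|nzf] := eqVneq f 0.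
  by exists g; split=> //; [apply: divides0 | apply: divides_refl].
have [n [t [A [phi [model]]]]] := model_of_pair f g.
have [gcdA inj_phi _ _ _] := model.
move=> [s [k [p [_ Ep]]]] [r [l [q [_ Eq]]]].
have phi_neq0 x : x != 0 -> phi x != 0.
  by move=> nzx; apply: contraNneq nzx => /inj_phi->.
have nzp : p != 0.
  by apply: contraNneq nzf => p0; rewrite -[f](monoVK k) -Ep p0 rmorph0 mulr0.
have [d [p' [q' [nzd Edp Edq cop]]]] := gcd_cofactors (@idomain_domain A) gcdA q nzp.
have nzp' : p' != 0 by apply: contraNneq nzp => p'0; rewrite Edp p'0 mulr0.
have dvdX m h : divides (phi d) (mono 1 m * h) -> divides (phi d) h.
  by move/(divides_mull (mono 1 (- m))); rewrite monoVK.
exists (phi d); split=> [||e ef eg].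
- by apply: (dvdX k); rewrite -Ep Edp rmorphM; exists (phi p').
- by apply: (dvdX l); rewrite -Eq Edq rmorphM; exists (phi q').
have [u Eu] : divides e (phi p) by rewrite Ep; apply: divides_mull.
have [v Ev] : divides e (phi q) by rewrite Eq; apply: divides_mull.
have [w Ew] : divides (phi p') u.
  apply: (model_flat model cop (v := v)); apply: (dom_mulI domFG (phi_neq0 d nzd)).
  by rewrite [LHS]mulrA [RHS]mulrA -2!rmorphM -Edp -Edq Ev Eu mulrAC.
exists w; apply: (dom_mulI domFG (phi_neq0 p' nzp')).
by rewrite -rmorphM [p' * d]mulrC -Edp Eu Ew mulrCA.
Qed.

End LaurentModel.

(** * The group of differences of a cancellative monoid *)

Section FractionGroup.
Variables (M : nmodType) (cancM : cancellative M).
Implicit Types (k l : M) (x y : M * M).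
Local Open Scope quotient_scope.

(** A pair stands for the difference [x.1 - x.2]; cancellativity makes the relation transitive
    without an auxiliary summand. *)
Definition frac_rel x y := x.1 + y.2 == y.1 + x.2.

Fact frac_rel_refl : reflexive frac_rel.
Proof. by move=> x; apply: eqxx. Qed.

Fact frac_rel_sym : symmetric frac_rel.
Proof. by move=> x y; apply: eq_sym. Qed.

Fact frac_rel_trans : transitive frac_rel.
Proof.
move=> y x z /eqP Exy /eqP Eyz; apply/eqP; apply: (@cancM y.2).
by rewrite addrCA addrA Exy addrAC Eyz [RHS]addrCA addrA.
Qed.

Definition frac_equiv := EquivRel frac_rel frac_rel_refl frac_rel_sym frac_rel_trans.

Definition fraction_group := {eq_quot frac_equiv}.
Local Notation G := fraction_group.

HB.instance Definition _ := Choice.on G.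
HB.instance Definition _ := EqQuotient.on G.

Implicit Types a b c : G.

Lemma frac_eqP x y : \pi_G x = \pi_G y <-> x.1 + y.2 = y.1 + x.2.
Proof. by split=> [/eqquotP/eqP|E]; last by apply/eqquotP/eqP. Qed.

Lemma frac_repr x : (repr (\pi_G x)).1 + x.2 = x.1 + (repr (\pi_G x)).2.
Proof. by apply/frac_eqP; rewrite reprK. Qed.

Definition frac_zero : G := \pi_G (0, 0).
Definition frac_add a b : G :=
  \pi_G ((repr a).1 + (repr b).1, (repr a).2 + (repr b).2).
Definition frac_opp a : G := \pi_G ((repr a).2, (repr a).1).

Lemma frac_add_pi x y : frac_add (\pi_G x) (\pi_G y) = \pi_G (x.1 + y.1, x.2 + y.2).
Proof. by apply/frac_eqP; rewrite /= addrACA !frac_repr addrACA. Qed.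

Lemma frac_opp_pi x : frac_opp (\pi_G x) = \pi_G (x.2, x.1).
Proof. by apply/frac_eqP; rewrite /= addrC -frac_repr addrC. Qed.

Fact frac_addA : associative frac_add.
Proof.
elim/quotW=> x; elim/quotW=> y; elim/quotW=> z.
by rewrite (frac_add_pi y z) (frac_add_pi x y) !frac_add_pi /= !addrA.
Qed.

Fact frac_addC : commutative frac_add.
Proof.
by move=> a b; rewrite /frac_add addrC [(repr a).2 + _]addrC.
Qed.

Fact frac_add0 : left_id frac_zero frac_add.
Proof.
by elim/quotW=> x; rewrite frac_add_pi !add0r -surjective_pairing.
Qed.

Fact frac_addN : left_inverse frac_zero frac_opp frac_add.
Proof.
elim/quotW=> x; rewrite frac_opp_pi frac_add_pi /=; apply/frac_eqP.
by rewrite /= addr0 add0r addrC.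
Qed.

HB.instance Definition _ :=
  GRing.isZmodule.Build G frac_addA frac_addC frac_add0 frac_addN.

Definition to_frac k : G := \pi_G (k, 0).

Lemma to_fracD k l : to_frac (k + l) = to_frac k + to_frac l.
Proof. by rewrite [RHS]frac_add_pi /= addr0. Qed.

Lemma to_frac_inj : injective to_frac.
Proof. by move=> k l /frac_eqP /=; rewrite !addr0. Qed.

Lemma to_frac0 : to_frac 0 = 0.
Proof. by []. Qed.

Lemma fraction_groupP a : exists k l, a + to_frac l = to_frac k.
Proof.
elim/quotW: a => x; exists x.1, x.2; rewrite [LHS]frac_add_pi.
by apply/frac_eqP; rewrite /= !addr0.
Qed.

Lemma to_fracMn k n : to_frac (k *+ n) = to_frac k *+ n.
Proof.
by elim: n => [|n IHn]; rewrite ?mulr0n ?to_frac0 // !mulrS to_fracD IHn.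
Qed.

(** With [a] and [b] written as differences, clearing denominators turns an equality of multiples in
    [G] into one in [M]. *)
Lemma fraction_group_torsion_free : torsion_free M -> torsion_free G.
Proof.
move=> tfM n a b n_gt0 Eab.
have [k [l Ea]] := fraction_groupP a; have [i [j Eb]] := fraction_groupP b.
suff E : k + j = i + l.
  apply: (@addIr _ (to_frac l + to_frac j)).
  by rewrite addrA Ea [to_frac l + _]addrC [RHS]addrA Eb -!to_fracD E.
apply: (tfM n) => //; apply: to_frac_inj.
by rewrite !to_fracMn !to_fracD -Ea -Eb addrAC 2!mulrnDl Eab -!mulrnDl addrAC.
Qed.

End FractionGroup.

(** * From MCDs to gcds in a pre-Schreier monoid *)

Section MonoidGcd.
Variable M : nmodType.
Hypotheses (cancM : cancellative M) (psM : pre_schreier M) (mcdM : mcd_monoid M).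
Implicit Types (k l m : M) (S : seq M).

Lemma mdivides_refl k : mdivides k k.
Proof. by exists 0; rewrite addr0. Qed.

Lemma mdivides_trans k l m : mdivides k l -> mdivides l m -> mdivides k m.
Proof. by move=> [a ->] [b ->]; exists (a + b); rewrite addrA. Qed.

Lemma mdivides_add2l k l m : mdivides k l -> mdivides (m + k) (m + l).
Proof. by move=> [a ->]; exists a; rewrite addrA. Qed.

Lemma mdivides_add2lP k l m : mdivides (m + k) (m + l) -> mdivides k l.
Proof. by move=> [a]; rewrite -addrA => /cancM ->; exists a. Qed.

(** Riesz interpolation by two uses of primality. With [k = a + u] and [l = a + v], split
    [b = b1 + b2] along [a + u]; after cancelling [b1], split [b2 = p + q] along [a' + v], where
    [a = b1 + a']. Then [b1 + p] divides [a], while [q] divides both [u] and [v], so [a + q]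
    interpolates. *)
Lemma mdivides_interpolate2 a b k l :
    mdivides a k -> mdivides b k -> mdivides a l -> mdivides b l ->
  exists c, [/\ mdivides a c, mdivides b c, mdivides c k & mdivides c l].
Proof.
move=> [u Ek] bk [v El] bl.
have /psM[b1 [b2 [Eb [a' Ea] b2u]]] : mdivides b (a + u) by rewrite -Ek.
have /psM[p [q [Eb2 pa' qv]]] : mdivides b2 (a' + v).
  by apply: (@mdivides_add2lP _ _ b1); rewrite -Eb addrA -Ea -El.
exists (a + q); split; first by exists q.
- rewrite Eb Eb2 addrA; case: pa' => r Ea'; exists r.
  by rewrite Ea Ea' addrA addrAC.
- rewrite Ek; apply: mdivides_add2l; apply: mdivides_trans b2u.
  by exists p; rewrite addrC.
by rewrite El; apply: mdivides_add2l.
Qed.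

Lemma mdivides_interpolate a b k S :
    (forall s, s \in k :: S -> mdivides a s) -> (forall s, s \in k :: S -> mdivides b s) ->
  exists c, [/\ mdivides a c, mdivides b c & forall s, s \in k :: S -> mdivides c s].
Proof.
elim: S => [|l S IHS] aS bS.
  exists k; split; [by apply: aS; rewrite inE | by apply: bS; rewrite inE |].
  by move=> s; rewrite inE => /eqP->; apply: mdivides_refl.
have sub s : s \in k :: S -> s \in [:: k, l & S].
  by rewrite !inE => /orP[->//|->]; rewrite !orbT.
have ml : l \in [:: k, l & S] by rewrite !inE eqxx orbT.
have [c [ac bc cS]] := IHS (fun s sS => aS s (sub s sS)) (fun s sS => bS s (sub s sS)).
have [d [ad bd dc dl]] := mdivides_interpolate2 ac bc (aS l ml) (bS l ml).
exists d; split=> // s; rewrite [s \in _]inE [s \in _]inE orbCA => /orP[/eqP->//|sS].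
by apply: mdivides_trans dc _; apply: cS; rewrite inE; exact: sS.
Qed.

(* Interpolating an arbitrary common divisor with an MCD gives a common divisor
   that differs from the MCD by a unit. *)
Lemma mcd_gcd k S : exists d, (forall s, s \in k :: S -> mdivides d s) /\
  forall e, (forall s, s \in k :: S -> mdivides e s) -> mdivides e d.
Proof.
pose A := seq_fset tt (k :: S).
have [|d [dA maxd]] := mcdM (A := A).
  by apply/fset0Pn; exists k; rewrite seq_fsetE mem_head.
have AE s : (s \in A) = (s \in k :: S) by rewrite seq_fsetE.
have dS s : s \in k :: S -> mdivides d s by rewrite -AE; apply: dA.
exists d; split=> // e eS.
have [c [[u Ec] ec cS]] := mdivides_interpolate dS eS.
have [|v uv0] := maxd u.
  move=> w [s]; rewrite AE => /cS cs Es.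
  by apply: (@mdivides_add2lP _ _ d); rewrite -Ec -Es.
by apply: mdivides_trans ec _; exists v; rewrite Ec -addrA uv0 addr0.
Qed.

End MonoidGcd.

(** * Descent of gcds from F[G] to F[M] *)

Section MonoidAlgebraGcd.
Variables (F : fieldType) (M : nmodType) (G : zmodType) (h : M -> G).
Hypotheses (cancM : cancellative M) (tfG : torsion_free G).
Hypotheses (hD : forall k l, h (k + l) = h k + h l) (h_inj : injective h).
Hypothesis hP : forall a, exists k l, a + h l = h k.
Local Notation FM := (monoid_algebra F M).
Local Notation FG := (monoid_algebra F G).
Local Notation iota := (@map_exp F M G h).
Implicit Types (k l m : M) (f g : FM) (u v w : FG).

Let domFG := @group_algebra_domain F G tfG.

Let iota0 : iota 0 = 0.
Proof. exact: map_exp0. Qed.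

Let iotaD f g : iota (f + g) = iota f + iota g.
Proof. exact: map_expD. Qed.

Let iotaM f g : iota (f * g) = iota f * iota g.
Proof. exact: map_expM. Qed.

Let iota_mono (a : F) k : iota (mono a k) = mono a (h k).
Proof. exact: map_exp_mono. Qed.

Let iota_inj : injective iota.
Proof. exact: map_exp_inj. Qed.

Lemma iota_neq0 f : f != 0 -> iota f != 0.
Proof.
by apply: contraNneq => f0; apply/eqP/iota_inj; rewrite f0 iota0.
Qed.

Lemma monoid_algebra_domain : GRing.integral_domain_axiom FM.
Proof.
move=> f g fg0; apply: contraT; rewrite negb_or => /andP[/iota_neq0 nzf /iota_neq0 nzg].
by have := dom_mulf_neq0 domFG nzf nzg; rewrite -iotaM fg0 iota0 eqxx.
Qed.

Lemma clear_denominators u : exists m f, iota f = mono 1 (h m) * u.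
Proof.
apply: (@monoid_algebra_ind F G (fun u => exists m f, iota f = mono 1 (h m) * u))
    => [|u1 u2 [m1 [f1 E1]] [m2 [f2 E2]]|k _].
- by exists 0, 0; rewrite mulr0 iota0.
- exists (m1 + m2), (mono 1 m2 * f1 + mono 1 m1 * f2).
  rewrite iotaD !iotaM !iota_mono E1 E2 hD mulrDr.
  by rewrite !mulrA !monoM !mulr1 [h m2 + h m1]addrC.
have [l [m E]] := hP k.
by exists m, (mono u@_k l); rewrite iota_mono monoM mul1r addrC E.
Qed.

(** Every element of F[G] becomes an element of F[M] after multiplication by a monomial, so a gcd
    taken in F[G] and its cofactors can be pulled back at the cost of monomial multipliers, the form
    required by [gcds_from_localization]. *)
Lemma local_gcd f g : f != 0 -> g != 0 -> exists d m1 m2,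
  [/\ d != 0, divides d (mono 1 m1 * f), divides d (mono 1 m2 * g)
    & forall e, divides e f -> divides e g -> exists m, divides e (mono 1 m * d)].
Proof.
move=> nzf nzg.
have [d [[u Ef] [v Eg] maxd]] := @group_algebra_has_gcds F G tfG (iota f) (iota g).
have [m [d' Ed']] := clear_denominators d.
have nzd : d != 0.
  by have := iota_neq0 nzf; apply: contraNneq => d0; rewrite Ef d0 mul0r.
have dvd z w : iota z = d * w -> exists m1, divides d' (mono 1 m1 * z).
  move=> Ez; have [m1 [w' Ew']] := clear_denominators w.
  exists (m + m1), w'; apply: iota_inj.
  by rewrite !iotaM iota_mono Ez Ed' Ew' hD -[1]mulr1 -monoM mulrACA mulr1.
have [m1 dvd1] := dvd _ _ Ef; have [m2 dvd2] := dvd _ _ Eg.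
exists d', m1, m2; split=> //.
  have := dom_mulf_neq0 domFG (mono1_neq0 F (h m)) nzd.
  by rewrite -Ed'; apply: contraNneq => ->; rewrite iota0.
move=> e [x Ex] [y Ey]; have [||w Ew] := maxd (iota e).
- by exists (iota x); rewrite -iotaM -Ex.
- by exists (iota y); rewrite -iotaM -Ey.
have [m3 [w' Ew']] := clear_denominators w.
exists m3, (mono 1 m * w'); apply: iota_inj.
rewrite (iotaM (mono 1 m3)) (iotaM e) (iotaM (mono 1 m)) !iota_mono Ed' Ew' Ew.
have shuffle (R : comNzRingType) (a b c z : R) : a * (b * (c * z)) = c * (b * (a * z)).
  by rewrite mulrCA [RHS]mulrCA; congr (_ * _); rewrite mulrCA.
exact: shuffle.
Qed.

Lemma msupp_drop f k : k \in msupp f ->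
  (#|` msupp (f - mono f@_k k)| < #|` msupp f|)%N.
Proof.
move=> kf; apply: fproper_ltn_card; rewrite fproperE; apply/andP; split.
  apply/fsubsetP => l; rewrite -!mcoeff_neq0 coeffD coeffN coeff_mono.
  by case: ifP => [/eqP<-|_]; rewrite ?subrr ?eqxx ?subr0.
apply/negP => /fsubsetP/(_ k kf); rewrite -mcoeff_neq0 coeffD coeffN coeff_mono.
by rewrite eqxx subrr eqxx.
Qed.

Lemma divides_mono_term m k (a : F) : mdivides m k -> divides (mono 1 m) (mono a k).
Proof. by move=> [l ->]; exists (mono a l); rewrite monoM mul1r. Qed.

(** Translation by [m] is injective on exponents. In Gauss' lemma this keeps the induction measure
    from growing when [g] is replaced by its cofactor [g']. *)
Lemma card_msuppM_mono m f : (#|` msupp f| <= #|` msupp (mono 1 m * f)|)%N.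
Proof.
have <- : #|` [fset m + k | k in msupp f]| = #|` msupp f|.
  by rewrite (card_imfset _ _ (@cancM m)).
apply: fsubset_leq_card.
apply/fsubsetP => _ /imfsetP[k /= kf ->].
by rewrite -mcoeff_neq0 coeff_monoM // mul1r mcoeff_neq0.
Qed.

Hypothesis psM : pre_schreier M.

Let domFM := monoid_algebra_domain.

(* Any exponent k + l in the support of f * g plays the part of the leading
   term in Gauss' lemma: m splits along it, the terms at k and l are removed. *)
Lemma monoid_gauss_coprime m f g :
    (forall e, mdivides e m -> divides (mono (1 : F) e) f -> mdivides e 0) ->
  divides (mono 1 m) (f * g) -> divides (mono 1 m) g.
Proof.
have [n] := ubnP (#|` msupp f| + #|` msupp g|).
elim: n m f g => // n IHn m f g le_n cop.
have [->|nzg] := eqVneq g 0; first by move=> _; apply: divides0.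
have [f0|nzf] := eqVneq f 0.
  (* Every monomial divides 0, so coprimality applied to [m] itself makes [m] a unit. *)
  move=> _; apply/divides_monoP => k _; apply: mdivides_trans (_ : mdivides 0 k).
    by apply: cop; [apply: mdivides_refl | rewrite f0; apply: divides0].
  by exists k; rewrite add0r.
move=> mfg; have [_ /[dup] /msuppM_exists[k [l [kf lg ->]]] klfg] :=
  msupp_neq0 (dom_mulf_neq0 domFM nzf nzg).
have /divides_monoP/(_ _ klfg) := mfg.
case/psM=> m1 [m2 [Em m1k m2l]].
have [m1m m2m] : mdivides m1 m /\ mdivides m2 m.
  by split; [exists m2 | exists m1; rewrite addrC].
have monoE : mono (1 : F) m = mono 1 m2 * mono 1 m1 by rewrite monoM mulr1 Em addrC.
have m2fg : divides (mono 1 m2) (f * g).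
  by apply: divides_trans mfg; exists (mono 1 m1).
have [g' Eg] : divides (mono 1 m2) g.
  have m2r := divides_mono_term g@_l m2l.
  rewrite -[g](subrK (mono g@_l l)); apply: (dividesD _ m2r); apply: (IHn m2 f) => //.
  - by rewrite -ltnS; apply: leq_trans le_n; rewrite ltnS ltn_add2l; apply: msupp_drop.
  - by move=> e em2; apply: cop; apply: mdivides_trans em2 m2m.
  - by rewrite mulrBr; apply: dividesB => //; apply: divides_mull.
rewrite monoE Eg; apply: divides_mul2l.
have m1r := divides_mono_term f@_k m1k.
apply: (IHn m1 (f - mono f@_k k)).
- have := msupp_drop kf; have := card_msuppM_mono m2 g'; rewrite -Eg; lia.
- move=> e em1 er; apply: cop; first exact: mdivides_trans m1m.
  rewrite -[f](subrK (mono f@_k k)); apply: dividesD er _.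
  by apply: divides_trans m1r; apply/divides_mono.
rewrite mulrBl; apply: dividesB; last exact: divides_mulr.
apply: (@divides_mul2lP _ domFM _ _ (mono 1 m2)); first exact: mono1_neq0.
by rewrite mulrCA -Eg -monoE.
Qed.

Hypothesis mcdM : mcd_monoid M.

Definition monomial f := exists k, f = mono 1 k.

Lemma monoid_algebra_has_gcds : has_gcds FM.
Proof.
apply: (@gcds_from_localization _ domFM monomial).
- by move=> _ [k ->]; apply: mono1_neq0.
- by move=> _ _ [k ->] [l ->]; exists (k + l); rewrite monoM mulr1.
(* [k] is an exponent of [f], put at the head because [mcd_gcd] speaks of nonempty lists. *)
- move=> f g nzf nzg; have [k kf] := msupp_neq0 nzf.
  have [d [dS maxd]] := mcd_gcd cancM psM mcdM k (msupp f ++ msupp g).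
  exists (mono 1 d); split.
  + by exists d.
  + by apply/divides_monoP => l lf; apply: dS; rewrite inE mem_cat lf orbT.
  + by apply/divides_monoP => l lg; apply: dS; rewrite inE mem_cat lg !orbT.
  move=> _ [e ->] /divides_monoP ef /divides_monoP eg; apply/divides_mono; apply: maxd => s.
  by rewrite inE mem_cat => /orP[/eqP->|/orP[]]; [apply: ef|apply: ef|apply: eg].
- move=> f _ g prim_f _ [m ->]; apply: monoid_gauss_coprime => e em ef.
  by apply/(divides_mono F); rewrite mono10; apply: prim_f => //; exists e.
move=> f g nzf nzg; have [d [m1 [m2 [nzd d1 d2 maxd]]]] := local_gcd nzf nzg.
exists d, (mono 1 m1), (mono 1 m2), 1; split; split=> //; try by eexists.
move=> e ef eg; have [m em] := maxd e ef eg.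
by exists (mono 1 m); split=> //; exists m.
Qed.

End MonoidAlgebraGcd.

(** * From gcds to MCDs, and the conclusion *)

(** If [e] divides every quotient by the gcd [d], then [d * e] is again a common divisor, so it
    divides [d] and [e] is a unit. *)
Lemma gcd_mcd_domain (R : comNzRingType) (domR : GRing.integral_domain_axiom R) :
  has_gcds R -> mcd_domain R.
Proof.
move=> gcdR; exists domR => A /fset0Pn[a aA].
have [d [dA maxd]] := gcd_seq gcdR [seq val s | s <- A].
have nzd : d != 0.
  (* The gcd divides the nonzero element [a], so it is itself nonzero. *)
  apply: contraNneq (valP a) => d0; have [|z ->] := dA (val a); first exact: map_f.
  by rewrite d0 mul0r.
have mdividesE (x y : nonzero domR) : divides (val x) (val y) -> mdivides x y.
  move=> [z Ez]; have nzz : z != 0.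
    by apply: contraNneq (valP y) => z0; rewrite Ez z0 mulr0.
  by exists (Sub z nzz); apply: val_inj.
exists (Sub d nzd); split=> [s sA|e eA].
  by apply: mdividesE; apply: dA; apply: map_f.
have [z Ez] : divides (d * val e) d.
  apply: maxd => _ /mapP[s sA ->].
  have [|c Es] := dA (val s); first exact: map_f.
  have nzc : c != 0 by apply: contraNneq (valP s) => c0; rewrite Es c0 mulr0.
  have [|y Ey] := eA (Sub c nzc); first by exists s => //; apply: val_inj.
  by rewrite Es; apply: divides_mul2l; exists (val y); have := congr1 val Ey.
(* The [0] of the additively written monoid [nonzero domR] is the unit 1 of [R], so this says that
   [e] is invertible. *)
have [b Eb] : mdivides e 0.
  by apply: mdividesE; exists z; apply: (dom_mulI domR nzd); rewrite mulr1 mulrA.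
by exists b.
Qed.

Theorem theorem3p11 (F : fieldType) (M : nmodType)
  (cancM : cancellative M) (tfM : torsion_free M) (psM : pre_schreier M)
  (mcdM : mcd_monoid M) :
  mcd_domain (monoid_algebra F M).
Proof.
have tfG := fraction_group_torsion_free (cancM := cancM) tfM.
have hD := to_fracD cancM; have h_inj := @to_frac_inj M cancM.
have hP := @fraction_groupP M cancM.
apply: (gcd_mcd_domain (@monoid_algebra_domain F M _ _ tfG hD h_inj)).
exact: (@monoid_algebra_has_gcds F M _ _ cancM tfG hD h_inj hP psM mcdM).
Qed.
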